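(* If $D$ is a $(k,n)$-transversal design with $k \leq n$, then $L(D) = \frac{1}{k}$.
   Context: A covering design is a pair $(X,\mathcal{B})$ with $X$ a finite set of points and $\mathcal{B}$ a finite multiset of subsets of $X$ (blocks) such that every pair of distinct points lies together in at least one block; a linear space is one where every pair of distinct points lies in exactly one block. A $(k,n)$-transversal design is a linear space $(X,\mathcal{B})$ with $|X|=kn$ whose blocks consist of $k$ blocks of size $n$ that partition $X$, together with $n^2$ other blocks of size $k$. A weighting of $X$ assigns nonnegative reals to points, $w(S)=\sum_{x\in S}w(x)$, normalised means $w(X)=1$. $L(D,w)=\max\{w(B):B\in\mathcal{B}\}$ and $L(D)$ is the infimum of $L(D,w)$ over all normalised weightings $w$ of $X$. *)

(* Defs.v *)
From HB Require Import structures.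
From mathcomp Require Import all_boot all_order all_algebra.
From mathcomp Require Import finmap multiset.
From mathcomp Require Import boolp classical_sets reals.

Set Implicit Arguments.
Unset Strict Implicit.
Unset Printing Implicit Defensive.

Import Order.TTheory GRing.Theory Num.Theory.

Local Open Scope ring_scope.

Record design := Design {
  points : finType;
  blocks : {mset {set points}}%mset }.

(* Blocks are counted with multiplicity. *)
Definition linear_space (D : design) : Prop :=
  forall x y : points D, x != y ->
    count (fun B : {set points D} => (x \in B) && (y \in B)) (blocks D) = 1%N.

(* P is the set of the k groups and T the multiset of the n^2 other blocks. *)
Definition transversal_design (k n : nat) (D : design) : Prop :=
  [/\ linear_space D,
      #|points D| = (k * n)%N &
      exists (P : {set {set points D}}) (T : {mset {set points D}}%mset),
        [/\ blocks D = (seq_mset (enum P) `+` T)%mset,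
            finset.partition P [set: points D]%SET /\ #|P| = k,
            (forall B : {set points D}, B \in P -> #|B| = n),
            size T = (n ^ 2)%N &
            forall B : {set points D}, B \in T -> #|B| = k]].

Section Weightings.
Variables (R : realType) (D : design).
Implicit Types (w : points D -> R).

Definition weighting w : Prop := forall x, 0 <= w x.

Definition weight w (S : {set points D}) : R := \sum_(x in S) w x.

Definition normalised w : Prop := weight w [set: points D]%SET = 1.

(* For a weighting w the default value 0 is a lower bound of all block weights,
   so it matters only if D has no block. *)
Definition max_weight w : R :=
  \big[Num.max/0]_(B <- blocks D) weight w B.

Definition L : R :=
  inf [set max_weight w | w in [set w | weighting w /\ normalised w]]%classic.

End Weightings.

(* Main.v *)
Require Import Defs.
From mathcomp Require Import all_boot all_order all_algebra reals.
From mathcomp Require Import finmap multiset classical_sets.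

Import Order.TTheory GRing.Theory Num.Theory.

(** The [k] groups partition the points, so under any normalised weighting their
    weights sum to [1] and one of them weighs at least [1/k].  Conversely, under
    the uniform weighting a group weighs [n/(kn) = 1/k], and any other block
    weighs [k/(kn) = 1/n <= 1/k]. *)

Local Open Scope ring_scope.

Section BlockWeights.
Variables (R : realType) (D : design).
Implicit Types (w : points D -> R) (P : {set {set points D}}).

Lemma weight_le_max_weight w (B : {set points D}) :
  B \in blocks D -> weight w B <= max_weight w.
Proof. by move=> BD; exact: le_bigmax_seq. Qed.

(** The assumption [0 <= c] handles the default value 0 from which the maximum starts. *)
Lemma max_weight_le w (c : R) : 0 <= c ->
  (forall B, B \in blocks D -> weight w B <= c) -> max_weight w <= c.
Proof.
move=> c_ge0 wc; rewrite /max_weight big_seq.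
by apply: bigmax_le => // B BD; exact: wc.
Qed.

(** The total weight 1 splits into the weights of the [#|P|] parts, each at most [max_weight w]. *)
Lemma partition_max_weight w P :
  normalised w -> finset.partition P [set: points D]%SET ->
  (forall B, B \in P -> B \in blocks D) -> 1 <= max_weight w *+ #|P|.
Proof.
move=> <- partP PD; rewrite /weight (set_partition_big _ partP) /=.
rewrite -sumr_const; apply: ler_sum => B BP.
exact/weight_le_max_weight/PD.
Qed.

Lemma weight_const (c : R) (B : {set points D}) :
  weight (fun=> c) B = c * #|B|%:R.
Proof. by rewrite mulr_natr; exact: sumr_const. Qed.

(** The weighting [w0] both bounds the infimum above by [c] and shows that the set of values is
    nonempty; the bound [c] from below makes [inf] meaningful. *)
Lemma L_eq (c : R) w0 : weighting w0 -> normalised w0 -> max_weight w0 <= c ->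
  (forall w, weighting w -> normalised w -> c <= max_weight w) -> L R D = c.
Proof.
move=> w0_ge0 w0_norm w0c cw; apply/le_anti/andP; split.
  apply: le_trans w0c; apply: ge_inf; last by exists w0.
  by exists c => _ [w [w_ge0 w_norm] <-]; exact: cw.
apply: lb_le_inf; first by exists (max_weight w0), w0.
by move=> _ [w [w_ge0 w_norm] <-]; exact: cw.
Qed.

End BlockWeights.

Theorem theorem6p6 (R : realType) (k n : nat) (D : design)
    (k_gt0 : (0 < k)%N) (D_TD : transversal_design k n D) (le_kn : (k <= n)%N) :
  L R D = 1 / k%:R.
Proof.
case: D_TD => _ cardD [P [T [DE [partP cardP] sizeP _ sizeT]]].
have k_pos : 0 < k%:R :> R by rewrite ltr0n.
have n_pos : 0 < n%:R :> R by rewrite ltr0n (leq_trans k_gt0).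
(* A maximum ignores multiplicities, so membership in the multiset of blocks is enough. *)
have memD B : (B \in blocks D) = (B \in P) || (B \in T).
  by rewrite DE in_msetD (perm_mem (perm_eq_seq_mset _)) mem_enum.
(* The uniform weighting on the [k * n] points is the optimal one. *)
apply: (@L_eq _ _ _ (fun=> (k * n)%:R^-1)).
- by move=> x; rewrite invr_ge0 ler0n.
- rewrite /normalised weight_const cardsT cardD mulVf //.
  by rewrite natrM mulf_neq0 ?gt_eqF.
- apply: max_weight_le => [|B]; first by rewrite divr_ge0 ?ler0n.
  rewrite memD weight_const natrM invfM mul1r.
  case/orP => [/sizeP|/sizeT] ->; first by rewrite mulfVK ?gt_eqF.
  by rewrite mulrAC mulVf ?gt_eqF // mul1r lef_pV2 ?posrE // ler_nat.
(* Clearing the denominator [k], which is the number of groups, leaves the bound for the partition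
   [P]. *)
- move=> w _ w_norm; rewrite ler_pdivrMr // mulr_natr -cardP.
  by apply: partition_max_weight => // B BP; rewrite memD BP.
Qed.
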